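(* Let $G$ be a Hausdorff $2$-semitopological group. Then $G$ is weakly-$qg$-separated, i.e. its quasitopological group reflexion $G^{qg}$ is weakly Hausdorff.
   Context: A semitopological group is a group with a topology making multiplication separately continuous; a quasitopological group is a semitopological group with continuous inversion. A semitopological group $G$ is a $2$-semitopological group if for every $g\in G$ with $e\notin\overline{\{g\}}$ there is a neighborhood $W$ of the neutral element $e$ with $g\notin W^{2}=WW$. For a semitopological group $(G,\tau)$, the quasitopological group reflexion $G^{qg}=(G,\tau^{qg})$ is the group $G$ endowed with the strongest topology $\tau^{qg}\subset\tau$ that turns $G$ into a quasitopological group. Weak base: let $\mathscr{P}=\bigcup_{x\in X}\mathscr{P}_x$ be a cover of a space $X$ such that for each $x\in X$: (a) if $U,V\in\mathscr{P}_x$ then $W\subset U\cap V$ for some $W\in\mathscr{P}_x$; (b) $x\in\bigcap\mathscr{P}_x$, and whenever $x\in U$ with $U$ open there is $P\in\mathscr{P}_x$ with $P\subset U$. Then $\mathscr{P}$ is a weak base for $X$ if every $A\subset X$ such that for each $x\in A$ there is $P\in\mathscr{P}_x$ with $P\subset A$ is open in $X$. A space $X$ is weakly Hausdorff if there exists a weak base $\mathscr{B}$ for $X$ such that for any distinct points $x,y\in X$ there exist $B_1,B_2\in\mathscr{B}$ with $x\in B_1$, $y\in B_2$ and $B_1\cap B_2=\emptyset$. *)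

(* Defs.v *)
From HB Require Import structures.
From mathcomp Require Import all_boot monoid.
From mathcomp Require Import all_classical topology.

Set Implicit Arguments.
Unset Strict Implicit.
Unset Printing Implicit Defensive.

Local Open Scope classical_set_scope.
Local Open Scope group_scope.

(* A group with a topology; no compatibility is assumed. *)
#[short(type="topologizedGroupType")]
HB.structure Definition TopologizedGroup :=
  {G of monoid.Group G & Topological G}.

Definition semitopological_group (G : topologizedGroupType) : Prop :=
  forall g : G,
    continuous (fun x : G => g * x) /\ continuous (fun x : G => x * g).

Definition quasitopological_group (G : topologizedGroupType) : Prop :=
  semitopological_group G /\ continuous (fun x : G => x^-1).

Definition two_semitopological_group (G : topologizedGroupType) : Prop :=
  semitopological_group G /\
  forall g : G, ~ closure [set g] (1 : G) ->
    exists2 W : set G, nbhs (1 : G) W & ~ [set x * y | x in W & y in W] g.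

(* The group G with its topology replaced by tau. *)
Definition retopologize (G : groupType) (tau : Topological G) : Type := G.

HB.instance Definition _ (G : groupType) (tau : Topological G) :=
  monoid.Group.on (@retopologize G tau).

HB.instance Definition _ (G : groupType) (tau : Topological G) :=
  hasNbhs.Build (@retopologize G tau) (@nbhs _ (Topological.Pack tau)).

HB.instance Definition _ (G : groupType) (tau : Topological G) :=
  Nbhs_isTopological.Build (@retopologize G tau)
    (@topology_structure.nbhs_pfilter_subproof (Topological.Pack tau))
    (@topology_structure.nbhsE_subproof (Topological.Pack tau))
    (@topology_structure.openE_subproof (Topological.Pack tau)).

Definition coarser_quasitopology (G : topologizedGroupType)
    (tau : Topological G) : Prop :=
  @open (retopologize tau) `<=` @open G /\
  quasitopological_group (retopologize tau).

(* G^{qg}, built as the supremum of all quasitopological group topologies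
   coarser than that of G. It is itself such a topology
   (qg_reflexion_coarser, qg_reflexion_quasitopological), hence the strongest
   one (qg_reflexion_max). *)
Definition qg_reflexion (G : topologizedGroupType) : Type :=
  sup_topology
    (fun t : {tau : Topological G | coarser_quasitopology tau} => sval t).

HB.instance Definition _ (G : topologizedGroupType) :=
  monoid.Group.copy (qg_reflexion G) G.

HB.instance Definition _ (G : topologizedGroupType) :=
  Topological.copy (qg_reflexion G) (sup_topology
    (fun t : {tau : Topological G | coarser_quasitopology tau} => sval t)).

Section QgReflexion.
Variable G : topologizedGroupType.

Lemma qg_reflexion_max (tau : Topological G) : coarser_quasitopology tau ->
  @open (retopologize tau) `<=` @open (qg_reflexion G).
Proof.
move=> tauq A oA.
pose Tc := fun t : {tau : Topological G | coarser_quasitopology tau} => sval t.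
rewrite openE => x Ax.
have /(@cvg_sup G _ Tc) /(_ (exist _ tau tauq)) :
  nbhs (x : qg_reflexion G) --> (x : qg_reflexion G) by [].
by apply; exact: (@open_nbhs_nbhs (retopologize tau)).
Qed.

Lemma qg_reflexion_cvg (F : set_system G) (x : G) : Filter F ->
  (forall tau : Topological G, coarser_quasitopology tau ->
     F --> (x : retopologize tau)) ->
  F --> (x : qg_reflexion G).
Proof.
move=> FF Fx.
pose Tc := fun t : {tau : Topological G | coarser_quasitopology tau} => sval t.
have [_] := @cvg_sup G _ Tc F x FF; apply; case=> tau tauq; exact: Fx.
Qed.

Lemma qg_reflexion_coarser : @open (qg_reflexion G) `<=` @open G.
Proof.
move=> A oA; rewrite openE => x Ax.
have : nbhs x --> (x : qg_reflexion G).
  apply: qg_reflexion_cvg => tau [le_tau _] B.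
  rewrite /= (@nbhsE (retopologize tau)) => -[C [oC Cx] CB].
  by rewrite nbhsE; exists C => //; split => //; exact: le_tau.
by apply; exact: open_nbhs_nbhs.
Qed.

Lemma qg_reflexion_quasitopological : quasitopological_group (qg_reflexion G).
Proof.
have cont (f : G -> G) :
  (forall tau, coarser_quasitopology tau ->
    continuous (f : retopologize tau -> retopologize tau)) ->
  continuous (f : qg_reflexion G -> qg_reflexion G).
  move=> fc x; apply: qg_reflexion_cvg => [|tau tauq].
    exact: (fmap_filter f (@nbhs_filter (qg_reflexion G) x)).
  have /cvg_trans : f @ nbhs (x : qg_reflexion G) `=>` f @ nbhs (x : retopologize tau).
    apply: cvg_app => B; rewrite /= (@nbhsE (retopologize tau)).
    move=> -[C [oC Cx] CB]; rewrite (@nbhsE (qg_reflexion G)).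
    by exists C => //; split => //; exact: (qg_reflexion_max tauq).
  by apply; exact: fc.
split; first by move=> g; split; apply: cont => tau [_ [/(_ g) []]].
by apply: cont => tau [_ []].
Qed.

End QgReflexion.

(* P x is the family attached to x; its members need not be open. *)
Record weak_base_at (X : topologicalType) (P : X -> set_system X) : Prop := {
  weak_base_cover : \bigcup_x \bigcup_(U in P x) U = [set: X];
  weak_baseI : forall x U V, P x U -> P x V ->
    exists2 W, P x W & W `<=` U `&` V;
  weak_base_mem : forall x U, P x U -> U x;
  weak_base_sub : forall x U, open U -> U x -> exists2 Q, P x Q & Q `<=` U;
  weak_base_open : forall A : set X,
    (forall x, A x -> exists2 Q, P x Q & Q `<=` A) -> open A
}.

Definition weak_base (X : topologicalType) (B : set_system X) : Prop :=
  exists2 P : X -> set_system X, weak_base_at P & B = \bigcup_x P x.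

(* B1 and B2 are any members of B containing x and y; they need not belong to
   the families attached to x and y. *)
Definition weakly_hausdorff (X : topologicalType) : Prop :=
  exists2 B : set_system X, weak_base B &
    forall x y : X, x <> y ->
      exists B1 B2, [/\ B B1, B B2, B1 x, B2 y & B1 `&` B2 = set0].

Definition weakly_qg_separated (G : topologizedGroupType) : Prop :=
  weakly_hausdorff (qg_reflexion G).

(* Main.v *)
(** Idea: the sets [x(U `|` U^-1)], with [U] a neighborhood of the identity,
    form a weak base of the quasitopological reflexion, because the topology
    that they weakly generate is itself a quasitopological group topology.
    Such sets at [x] and [y] are disjoint as soon as [g = x^-1 y] avoids
    [UU], [U^-1 U^-1], [U U^-1] and [U^-1 U]: the first two are provided by
    the 2-semitopological hypothesis for [g] and [g^-1], the last two by
    separating [1] from [g] in the Hausdorff space [G]. *)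
Require Import Defs.
From HB Require Import structures.
From mathcomp Require Import all_boot monoid.
From mathcomp Require Import all_classical topology.

Set Implicit Arguments.
Unset Strict Implicit.
Unset Printing Implicit Defensive.

Local Open Scope classical_set_scope.
Local Open Scope group_scope.

(** The union of xU and xU^-1: since [y^-1 * x] is the inverse of [x^-1 * y], the second disjunct
    puts [y] in xU^-1. *)
Definition sym_translate (G : groupType) (x : G) (U : set G) : set G :=
  [set y | U (x^-1 * y) \/ U (y^-1 * x)].

Lemma sym_translateS (G : groupType) (x : G) (U V : set G) :
  U `<=` V -> sym_translate x U `<=` sym_translate x V.
Proof. by move=> UV y [/UV|/UV]; [left|right]. Qed.

Definition sym_open (G : topologizedGroupType) : set_system G :=
  [set A | forall x, A x ->
    exists2 U, nbhs (1 : G) U & sym_translate x U `<=` A].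

Section SymTopology.
Variable G : topologizedGroupType.

(** An alias, so that the topology with open sets [sym_open] does not clash with the one that [G]
    carries. *)
Definition sym_group : Type := G.

HB.instance Definition _ := Choice.on sym_group.

Lemma sym_openT : @sym_open G setT.
Proof. by move=> x _; exists setT => //; exact: filterT. Qed.

Lemma sym_openI (A B : set G) : sym_open A -> sym_open B -> sym_open (A `&` B).
Proof.
move=> oA oB x [/oA[U nU UA] /oB[V nV VB]].
exists (U `&` V); first exact: filterI.
move=> y yUV; split; [apply: UA|apply: VB];
  by move: y yUV; apply: sym_translateS => ? [].
Qed.

Lemma sym_open_bigU (I : Type) (f : I -> set G) :
  (forall i, sym_open (f i)) -> sym_open (\bigcup_i f i).
Proof.
move=> of_ x [i _ /of_[U nU Uf]]; exists U => //.
by move=> y /Uf fy; exists i.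
Qed.

HB.instance Definition _ :=
  isOpenTopological.Build sym_group sym_openT sym_openI sym_open_bigU.

End SymTopology.

Definition sym_topology (G : topologizedGroupType) : Topological G :=
  Topological.class (sym_group G : topologicalType).

Lemma sym_topology_openE (G : topologizedGroupType) :
  @open (retopologize (sym_topology G)) = @sym_open G.
Proof. by []. Qed.

Section Semitopological.
Variable G : topologizedGroupType.
Hypothesis semiG : semitopological_group G.

Lemma nbhs_mulgl (x y : G) (U : set G) :
  nbhs (x * y) U -> nbhs y [set z | U (x * z)].
Proof. by have [cl _] := semiG x; exact: (cl y). Qed.

Lemma nbhs_mulgr (x y : G) (U : set G) :
  nbhs (y * x) U -> nbhs y [set z | U (z * x)].
Proof. by have [_ cr] := semiG x; exact: (cr y). Qed.

(** Conjugation is a left translation after a right one and fixes 1, so separate continuity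
    suffices. *)
Lemma nbhs1_conjg (g : G) (U : set G) :
  nbhs (1 : G) U -> nbhs (1 : G) [set u | U (u ^ g)].
Proof.
move=> nU; apply: (@nbhs_mulgr g 1 [set u | U (g^-1 * u)]).
by apply: nbhs_mulgl; rewrite mul1g mulVg.
Qed.

Lemma sym_open_sub (A : set G) : sym_open A -> open A.
Proof.
move=> oA; rewrite openE => x /oA[U nU UA].
apply: (@filterS _ _ _ [set z | U (x^-1 * z)]).
  by move=> z Uz; apply: UA; left.
by apply: nbhs_mulgl; rewrite mulVg.
Qed.

Lemma sym_quasitopological :
  quasitopological_group (retopologize (sym_topology G)).
Proof.
split; [move=> g; split|]; apply/continuousP => A;
  rewrite !sym_topology_openE => oA x /= /oA[U nU UA].
- exists U => // z Uz; apply: UA.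
  by rewrite /sym_translate /= !invgM -!mulgA !mulKg.
(* (xg)^-1(zg) is the conjugate of x^-1 z by g. *)
- exists [set u | U (u ^ g)]; first exact: nbhs1_conjg.
  move=> z Uz; apply: UA; move: Uz.
  by rewrite /sym_translate /= /conjg !invgM !mulgA.
(* Conjugating z^-1 x by x^-1 gives x z^-1, and x^-1 z gives z x^-1: inversion swaps the two
   disjuncts. *)
- exists [set u | U (u ^ x^-1)]; first exact: nbhs1_conjg.
  move=> z Uz; apply: UA; move: Uz.
  rewrite /sym_translate /= /conjg !invgK !mulgA mulgV mul1g mulgK.
  by case; [right|left].
Qed.

Lemma sym_coarser : coarser_quasitopology (sym_topology G).
Proof. by split; [exact: sym_open_sub | exact: sym_quasitopological]. Qed.

(** The points are those of the reflexion, but [U] ranges over neighborhoods in the original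
    topology of [G]. *)
Definition sym_base (x : qg_reflexion G) : set_system (qg_reflexion G) :=
  [set sym_translate (x : G) U | U in nbhs (1 : G)].

Lemma sym_base_mem (x : G) (A : set G) : sym_base x A -> A x.
Proof. by case=> U nU <-; left; rewrite mulVg; exact: nbhs_singleton. Qed.

Lemma sym_base_weak : weak_base_at sym_base.
Proof.
have [semiQ invQ] := qg_reflexion_quasitopological G.
split.
- apply/seteqP; split => // x _; exists x => //.
  exists (sym_translate (x : G) setT); last by left.
  by exists setT => //; exact: filterT.
- move=> x _ _ [U nU <-] [V nV <-]; exists (sym_translate (x : G) (U `&` V)).
    by exists (U `&` V) => //; exact: filterI.
  by move=> y yUV; split; apply: sym_translateS yUV => ? [].
- exact: sym_base_mem.
(* The preimages of [O] under u |-> xu and u |-> xu^-1 are open in the reflexion, hence in [G];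
   their intersection serves as [U]. *)
- move=> x O oO Ox.
  have [cl _] := semiQ x.
  have oO1 : open [set u : qg_reflexion G | O (x * u)].
    by move/continuousP: cl => /(_ _ oO).
  have oO2 : open [set u : qg_reflexion G | O (x * u^-1)].
    by move/continuousP: invQ => /(_ _ oO1).
  have nO1 : nbhs (1 : G) [set u : G | O (x * u)].
    apply: open_nbhs_nbhs; split; first exact: qg_reflexion_coarser.
    by rewrite /= mulg1.
  have nO2 : nbhs (1 : G) [set u : G | O (x * u^-1)].
    apply: open_nbhs_nbhs; split; first exact: qg_reflexion_coarser.
    by rewrite /= invg1 mulg1.
  exists (sym_translate (x : G)
      ([set u : G | O (x * u)] `&` [set u : G | O (x * u^-1)])).
    by eexists; first exact: filterI nO1 nO2.
  move=> y [[]|[_]] /=; first by rewrite mulVKg.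
  by rewrite invgM invgK mulVKg.
(* The assumption on [A] says that it is open in [sym_topology G], one of the topologies whose
   supremum is the reflexion. *)
- move=> A oA; apply: (qg_reflexion_max sym_coarser).
  rewrite sym_topology_openE => x /oA[_ [U nU <-] UA].
  by exists U.
Qed.

End Semitopological.

Lemma hausdorff_notin_closure1 (X : topologicalType) (x y : X) :
  hausdorff_space X -> y <> x -> ~ closure [set x] y.
Proof.
move=> hX yx clxy; apply: yx; apply: hX => A B nA nB.
have [z [-> Az]] := clxy _ nA.
by exists x; split => //; exact: nbhs_singleton.
Qed.

Lemma sym_translate_disjoint (G : topologizedGroupType) (x y : G) :
  hausdorff_space G -> two_semitopological_group G -> x <> y ->
  exists2 U, nbhs (1 : G) U & sym_translate x U `&` sym_translate y U = set0.
Proof.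
move=> hG [semiG twoG] xy; pose g := x^-1 * y.
have g1 : 1 <> g by move=> /(congr1 ( *%g x)); rewrite mulg1 mulVKg.
have gV1 : 1 <> g^-1 by move=> g1V; apply: g1; rewrite -[g]invgK -g1V invg1.
have [W1 nW1 gW1] := twoG g (hausdorff_notin_closure1 hG g1).
have [W2 nW2 gW2] := twoG g^-1 (hausdorff_notin_closure1 hG gV1).
have [O nO [O' nO' OO']] : exists2 O, nbhs (1 : G) O &
    exists2 O', nbhs g O' & forall z, O z -> O' z -> False.
  move: hG; rewrite open_hausdorff => /(_ 1 g); case; first exact/eqP.
  move=> [A B] /= [/set_mem A1 /set_mem Bg] [oA oB AB0].
  exists A; first exact: open_nbhs_nbhs.
  exists B; first exact: open_nbhs_nbhs.
  by move=> z Az Bz; have : (A `&` B) z by []; rewrite (eqP AB0).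
(* The last two sets force gU and Ug into [O'], hence off [O] and off U; this excludes g from U U^-1
   and U^-1 U. *)
exists (W1 `&` W2 `&` O `&` [set u | O' (g * u)] `&` [set u | O' (u * g)]).
  do !apply: filterI => //.
    by apply: nbhs_mulgl => //; rewrite mulg1.
  by apply: nbhs_mulgr => //; rewrite mul1g.
(* Let a and b in U witness that [z] lies in the translates at [x] and [y]. The four cases read gb =
   a, g = ab, g^-1 = ba and ag = b. *)
rewrite -subset0 => z [] /= [] [[[[a1 a2] a3] a4] a5] [] [[[[b1 b2] b3] b4] b5].
- by apply: OO' a3 _; move: b4; rewrite /= /g -mulgA mulVKg.
- apply: gW1; exists (x^-1 * z) => //; exists (z^-1 * y) => //.
  by rewrite /= mulgA mulgK.
- apply: gW2; exists (y^-1 * z) => //; exists (z^-1 * x) => //.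
  by rewrite /= mulgA mulgK /g invgM invgK.
- by apply: OO' b3 _; move: a5; rewrite /= /g mulgA mulgK.
Qed.

Theorem proposition2p5 (G : topologizedGroupType) :
  hausdorff_space G -> two_semitopological_group G -> weakly_qg_separated G.
Proof.
move=> hG twoG; have [semiG _] := twoG.
exists (\bigcup_x @sym_base G x).
  by exists (@sym_base G) => //; exact: sym_base_weak.
move=> x y xy; have [U nU U0] := sym_translate_disjoint hG twoG xy.
(* The same [U] serves both points, so each set comes from the family attached to its own point. *)
have bU z : sym_base z (sym_translate (z : G) U) by exists U.
exists (sym_translate (x : G) U), (sym_translate (y : G) U).
split; [by exists x | by exists y | exact: sym_base_mem (bU x)
  | exact: sym_base_mem (bU y) | exact: U0].
Qed.
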